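(* Let $\mathcal{O}_{\mathsf{NCP}}$ be the suboperad of $\mathsf{C}\mathbb{Z}$ generated by the two $\mathbb{Z}$-triangles $T(0;-1,0)$ and $T(0;0,-1)$. The operad $\mathcal{O}_{\mathsf{NCP}}$ is isomorphic to the operad $\mathsf{NCP}$ of based noncrossing trees.
   Context: All vector spaces are over a field $\mathbb{K}$ of characteristic zero; $[n]=\{1,\dots,n\}$. Operad means nonsymmetric operad in vector spaces, graded by arities $n\ge1$. $\mathbb{Z}$ is the additive unitary magma of integers, with unit $0$. A $\mathbb{Z}$-clique $\mathfrak{p}$ of arity $n\ge1$ is a map assigning to every arc $(x,y)$, $1\le x<y\le n+1$, a label $\mathfrak{p}(x,y)\in\mathbb{Z}$; by convention, the only $\mathbb{Z}$-clique of arity $1$ is the one with $\mathfrak{p}(1,2)=0$. Put $\mathfrak{p}_0:=\mathfrak{p}(1,n+1)$ and $\mathfrak{p}_i:=\mathfrak{p}(i,i+1)$ for $i\in[n]$. $\mathsf{C}\mathbb{Z}$ is the operad whose space $\mathsf{C}\mathbb{Z}(n)$ is the linear span of all $\mathbb{Z}$-cliques of arity $n$, whose unit is the unique $\mathbb{Z}$-clique of arity $1$, and where, for $\mathbb{Z}$-cliques $\mathfrak{p},\mathfrak{q}$ of arities $n,m$ and $i\in[n]$, $\mathfrak{p}\circ_i\mathfrak{q}$ is the $\mathbb{Z}$-clique of arity $n+m-1$ with $$(\mathfrak{p}\circ_i\mathfrak{q})(x,y)=\begin{cases}\mathfrak{p}(x,y)&\text{if }y\le i,\\ \mathfrak{p}(x,y-m+1)&\text{if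 }x\le i<i+m\le y,\ (x,y)\ne(i,i+m),\\ \mathfrak{p}(x-m+1,y-m+1)&\text{if }i+m\le x,\\ \mathfrak{q}(x-i+1,y-i+1)&\text{if }i\le x<y\le i+m,\ (x,y)\ne(i,i+m),\\ \mathfrak{p}_i+\mathfrak{q}_0&\text{if }(x,y)=(i,i+m),\\ 0&\text{otherwise.}\end{cases}$$ $T(a;b,c)$ denotes the $\mathbb{Z}$-clique of arity $2$ (a $\mathbb{Z}$-triangle) with $\mathfrak{p}_0=a$, $\mathfrak{p}_1=b$, $\mathfrak{p}_2=c$. $\mathsf{NCP}$ (Chapoton) is, up to isomorphism, the operad presented by two binary generators $\prec$ and $\succ$ subject to exactly one nontrivial relation $\prec\circ_1\succ\;=\;\succ\circ_2\prec$, i.e. in its algebras, $(a\succ b)\prec c=a\succ(b\prec c)$. *)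

(* Defs.v *)
From HB Require Import structures.
From mathcomp Require Import all_boot all_order all_algebra.
From mathcomp Require Import generic_quotient ring_quotient.
From mathcomp Require Import finmap boolp zify.
From mathcomp.multinomials Require Import monalg.

Set Implicit Arguments.
Unset Strict Implicit.
Unset Printing Implicit Defensive.

Import GRing.Theory.
Local Open Scope ring_scope.

(* Degree convention: every graded object below is indexed by n : nat, where the
   component of index n has arity n + 1.  Partial composition of arities
   n + 1 and m + 1 has arity (n + 1) + (m + 1) - 1 = (n + m) + 1.  Inputs are
   numbered from 0: the i-th input (1 <= i <= n + 1) is i - 1 : 'I_n.+1. *)

Definition scast (F : nat -> choiceType) m n (e : m = n) (x : F m) : F n :=
  let: erefl := e in x.

Definition gcast (K : fieldType) (F : nat -> lmodType K) m n (e : m = n)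
    (x : F m) : F n :=
  let: erefl := e in x.

Record set_operad := SetOperad {
  sop_space :> nat -> choiceType;
  sop_one : sop_space 0;
  sop_comp : forall n m, 'I_n.+1 -> sop_space n -> sop_space m ->
    sop_space (n + m);
  sop_comp1x : forall m (y : sop_space m), sop_comp ord0 sop_one y = y;
  sop_compx1 : forall n (i : 'I_n.+1) (x : sop_space n),
    scast (addn0 n) (sop_comp i x sop_one) = x;
  sop_compA : forall n m p (x : sop_space n) (y : sop_space m)
      (z : sop_space p) (i : 'I_n.+1) (j : 'I_m.+1) (k : 'I_(n + m).+1),
    k = (i + j)%N :> nat ->
    sop_comp i x (sop_comp j y z)
    = scast (esym (addnA n m p)) (sop_comp k (sop_comp i x y) z);
  sop_compAC : forall n m p (x : sop_space n) (y : sop_space m)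
      (z : sop_space p) (i k : 'I_n.+1)
      (i' : 'I_(n + p).+1) (k' : 'I_(n + m).+1),
    (i < k)%N -> i' = i :> nat -> k' = (k + m)%N :> nat ->
    sop_comp i' (sop_comp k x z) y
    = scast (addnAC n m p) (sop_comp k' (sop_comp i x y) z)
}.

Record operad (K : fieldType) := Operad {
  op_space :> nat -> lmodType K;
  op_one : op_space 0;
  op_comp : forall n m, 'I_n.+1 -> op_space n -> op_space m ->
    op_space (n + m);
  op_comp_linl : forall n m (i : 'I_n.+1) (y : op_space m),
    linear (fun x : op_space n => op_comp i x y);
  op_comp_linr : forall n m (i : 'I_n.+1) (x : op_space n),
    linear (fun y : op_space m => op_comp i x y);
  op_comp1x : forall m (y : op_space m), op_comp ord0 op_one y = y;
  op_compx1 : forall n (i : 'I_n.+1) (x : op_space n),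
    gcast (addn0 n) (op_comp i x op_one) = x;
  op_compA : forall n m p (x : op_space n) (y : op_space m)
      (z : op_space p) (i : 'I_n.+1) (j : 'I_m.+1) (k : 'I_(n + m).+1),
    k = (i + j)%N :> nat ->
    op_comp i x (op_comp j y z)
    = gcast (esym (addnA n m p)) (op_comp k (op_comp i x y) z);
  op_compAC : forall n m p (x : op_space n) (y : op_space m)
      (z : op_space p) (i k : 'I_n.+1)
      (i' : 'I_(n + p).+1) (k' : 'I_(n + m).+1),
    (i < k)%N -> i' = i :> nat -> k' = (k + m)%N :> nat ->
    op_comp i' (op_comp k x z) y
    = gcast (addnAC n m p) (op_comp k' (op_comp i x y) z)
}.

Arguments op_one {K}.
Notation "x \o_( i ) y" := (op_comp i x y)
  (at level 40, i at level 99, format "x  \o_( i )  y").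

Definition operad_isomorphic (K : fieldType) (A B : operad K) : Prop :=
  exists f : forall n, {linear A n -> B n},
    [/\ forall n, bijective (f n),
        f 0%N (op_one A) = op_one B
      & forall n m (i : 'I_n.+1) (x : A n) (y : A m),
          f (n + m)%N (x \o_(i) y) = f n x \o_(i) f m y].

Section Linearization.
Variable K : fieldType.

Definition lin_ext (T : choiceType) (V : lmodType K) (f : T -> V)
    (x : {malg K[T]}) : V :=
  \sum_(a <- msupp x) x@_a *: f a.

Lemma lin_extEw (T : choiceType) (V : lmodType K) (f : T -> V)
    (x : {malg K[T]}) (d : {fset T}) :
  (msupp x `<=` d)%fset -> lin_ext f x = \sum_(a <- d) x@_a *: f a.
Proof.
move=> sxd; rewrite /lin_ext [RHS](big_fsetID _ (mem (msupp x))) /=.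
rewrite [X in _ = _ + X]big1_fset ?addr0.
  by apply: eq_fbigl => a; rewrite !inE /=; case: (boolP (a \in msupp x)) =>
    [ax|]; rewrite ?andbF // (fsubsetP sxd _ ax).
move=> a; rewrite !inE /= => /andP[_ /mcoeff_outdom ->] _.
by rewrite scale0r.
Qed.

Lemma lin_ext_linear (T : choiceType) (V : lmodType K) (f : T -> V) :
  linear (lin_ext f).
Proof.
move=> c x y; pose d := (msupp (c *: x + y) `|` (msupp x `|` msupp y))%fset.
rewrite (@lin_extEw _ _ _ (c *: x + y) d) ?fsubsetUl //.
rewrite (@lin_extEw _ _ _ x d); last first.
  by rewrite fsubsetU // fsubsetUl orbT.
rewrite (@lin_extEw _ _ _ y d); last first.
  by rewrite fsubsetU // fsubsetUr orbT.
rewrite scaler_sumr -big_split /=; apply: eq_bigr => a _.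
by rewrite mcoeffD mcoeffZ scalerDl scalerA.
Qed.

HB.instance Definition _ (T : choiceType) (V : lmodType K) (f : T -> V) :=
  GRing.isLinear.Build K {malg K[T]} V *:%R (lin_ext f) (lin_ext_linear f).

Lemma lin_extU (T : choiceType) (V : lmodType K) (f : T -> V) a :
  lin_ext f << a >> = f a.
Proof.
rewrite (@lin_extEw _ _ _ _ [fset a]%fset) ?msuppU_le //.
by rewrite big_seq_fset1 mcoeffUU scale1r.
Qed.

Lemma malg_lin_ind (T : choiceType) (P : {malg K[T]} -> Prop) :
  P 0 -> (forall c a x, P x -> P (c *: << a >> + x)) -> forall x, P x.
Proof.
move=> P0 PD x; rewrite (monalgE x); elim/big_rec: _ => // a y _ Py.
suff -> : << x@_a *g a >> = x@_a *: << a >> :> {malg K[T]} by apply: PD.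
by apply/malgP => b; rewrite mcoeffZ !mcoeffU mulrnAr mulr1.
Qed.

Lemma lin_eq (T : choiceType) (V : lmodType K) (f g : {malg K[T]} -> V) :
  linear f -> linear g -> (forall a, f << a >> = g << a >>) -> f =1 g.
Proof.
move=> lf lg e; apply: malg_lin_ind => [|c a x IH].
  have := lf (-1) 0 0; have := lg (-1) 0 0.
  by rewrite scaler0 addr0 !scaleN1r !addNr => -> ->.
by rewrite lf lg e IH.
Qed.

Lemma gcast_linear (F : nat -> lmodType K) m n (e : m = n) :
  linear (gcast (F := F) e).
Proof. by case: _ / e. Qed.

Variable S : set_operad.

Definition lin_space (n : nat) : lmodType K := {malg K[S n]}.

Definition lin_one : lin_space 0 := << sop_one S >>.

Definition lin_comp n m (i : 'I_n.+1) (x : lin_space n) (y : lin_space m) :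
    lin_space (n + m) :=
  lin_ext (fun a => lin_ext (fun b => << sop_comp i a b >>) y) x.

Lemma lin_comp_linl n m (i : 'I_n.+1) (y : lin_space m) :
  linear (fun x : lin_space n => lin_comp i x y).
Proof. exact: lin_ext_linear. Qed.

Lemma lin_comp_linr n m (i : 'I_n.+1) (x : lin_space n) :
  linear (fun y : lin_space m => lin_comp i x y).
Proof.
move=> c y z; rewrite /lin_comp /lin_ext scaler_sumr -big_split /=.
apply: eq_bigr => a _; rewrite -!/(lin_ext _ _) lin_ext_linear scalerDr.
by rewrite !scalerA mulrC.
Qed.

Lemma lin_compU n m (i : 'I_n.+1) (a : S n) (b : S m) :
  lin_comp i (<< a >> : lin_space n) (<< b >> : lin_space m)
  = << sop_comp i a b >>.
Proof. by rewrite /lin_comp !lin_extU. Qed.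

Lemma lin_castU m n (e : m = n) (a : S m) :
  gcast e (<< a >> : lin_space m) = << scast e a >>.
Proof. by case: _ / e. Qed.

Lemma lin_comp1x m (y : lin_space m) : lin_comp ord0 lin_one y = y.
Proof.
move: y; apply: lin_eq => [||b]; [exact: lin_comp_linr | by [] |].
by rewrite lin_compU sop_comp1x.
Qed.

Lemma lin_compx1 n (i : 'I_n.+1) (x : lin_space n) :
  gcast (addn0 n) (lin_comp i x lin_one) = x.
Proof.
move: x; apply: lin_eq => [c x y||a]; [|by []|].
  by rewrite lin_comp_linl gcast_linear.
by rewrite lin_compU lin_castU sop_compx1.
Qed.

Lemma lin_compA n m p (x : lin_space n) (y : lin_space m) (z : lin_space p)
    (i : 'I_n.+1) (j : 'I_m.+1) (k : 'I_(n + m).+1) :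
  k = (i + j)%N :> nat ->
  lin_comp i x (lin_comp j y z)
  = gcast (esym (addnA n m p)) (lin_comp k (lin_comp i x y) z).
Proof.
move=> ek; move: x; apply: lin_eq => [c u v|c u v|a].
- by rewrite lin_comp_linl.
- by rewrite !lin_comp_linl gcast_linear.
move: y; apply: lin_eq => [c u v|c u v|b].
- by rewrite lin_comp_linl lin_comp_linr.
- by rewrite lin_comp_linr lin_comp_linl gcast_linear.
move: z; apply: lin_eq => [c u v|c u v|d].
- by rewrite !lin_comp_linr.
- by rewrite lin_comp_linr gcast_linear.
by rewrite !lin_compU lin_castU; congr << _ >>; apply: sop_compA.
Qed.

Lemma lin_compAC n m p (x : lin_space n) (y : lin_space m) (z : lin_space p)
    (i k : 'I_n.+1) (i' : 'I_(n + p).+1) (k' : 'I_(n + m).+1) :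
  (i < k)%N -> i' = i :> nat -> k' = (k + m)%N :> nat ->
  lin_comp i' (lin_comp k x z) y
  = gcast (addnAC n m p) (lin_comp k' (lin_comp i x y) z).
Proof.
move=> ik ei ek; move: x; apply: lin_eq => [c u v|c u v|a].
- by rewrite !lin_comp_linl.
- by rewrite !lin_comp_linl gcast_linear.
move: y; apply: lin_eq => [c u v|c u v|b].
- by rewrite lin_comp_linr.
- by rewrite lin_comp_linr lin_comp_linl gcast_linear.
move: z; apply: lin_eq => [c u v|c u v|d].
- by rewrite lin_comp_linr lin_comp_linl.
- by rewrite lin_comp_linr gcast_linear.
by rewrite !lin_compU lin_castU; congr << _ >>; apply: sop_compAC.
Qed.

Definition linearization : operad K :=
  Operad lin_comp_linl lin_comp_linr lin_comp1x lin_compx1 lin_compA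
    lin_compAC.

End Linearization.

Definition graded_pred (K : fieldType) (O : operad K) :=
  forall n, O n -> Prop.

Record suboperad (K : fieldType) (O : operad K) := Suboperad {
  sub_pred :> forall n, O n -> Prop;
  sub0 : forall n, @sub_pred n 0;
  sub_lin : forall n (c : K) (x y : O n),
    sub_pred x -> sub_pred y -> sub_pred (c *: x + y);
  sub_one : sub_pred (op_one O);
  sub_comp : forall n m (i : 'I_n.+1) (x : O n) (y : O m),
    sub_pred x -> sub_pred y -> sub_pred (x \o_(i) y)
}.

Record ideal (K : fieldType) (O : operad K) := Ideal {
  idl_pred :> forall n, O n -> Prop;
  idl0 : forall n, @idl_pred n 0;
  idl_lin : forall n (c : K) (x y : O n),
    idl_pred x -> idl_pred y -> idl_pred (c *: x + y);
  idl_compl : forall n m (i : 'I_n.+1) (x : O n) (y : O m),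
    idl_pred x -> idl_pred (x \o_(i) y);
  idl_compr : forall n m (i : 'I_n.+1) (x : O n) (y : O m),
    idl_pred y -> idl_pred (x \o_(i) y)
}.

Section Generated.
Variables (K : fieldType) (O : operad K) (G : graded_pred O).

Inductive gen_sub : graded_pred O :=
| gen_sub_in n (x : O n) : G x -> gen_sub x
| gen_sub0 n : @gen_sub n 0
| gen_sub_lin n (c : K) (x y : O n) :
    gen_sub x -> gen_sub y -> gen_sub (c *: x + y)
| gen_sub_one : gen_sub (op_one O)
| gen_sub_comp n m (i : 'I_n.+1) (x : O n) (y : O m) :
    gen_sub x -> gen_sub y -> gen_sub (x \o_(i) y).

Definition generated_suboperad : suboperad O :=
  Suboperad gen_sub0 gen_sub_lin gen_sub_one gen_sub_comp.

Inductive gen_idl : graded_pred O :=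
| gen_idl_in n (x : O n) : G x -> gen_idl x
| gen_idl0 n : @gen_idl n 0
| gen_idl_lin n (c : K) (x y : O n) :
    gen_idl x -> gen_idl y -> gen_idl (c *: x + y)
| gen_idl_compl n m (i : 'I_n.+1) (x : O n) (y : O m) :
    gen_idl x -> gen_idl (x \o_(i) y)
| gen_idl_compr n m (i : 'I_n.+1) (x : O n) (y : O m) :
    gen_idl y -> gen_idl (x \o_(i) y).

Definition generated_ideal : ideal O :=
  Ideal gen_idl0 gen_idl_lin gen_idl_compl gen_idl_compr.

End Generated.

Section SuboperadOperad.
Variables (K : fieldType) (O : operad K) (P : suboperad O).

Definition subb n : pred (O n) := fun x => `[< P n x >].

Lemma subb_submod n : submod_closed (@subb n).
Proof.
split; first by apply/asboolP; apply: sub0.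
by move=> c x y /asboolP Px /asboolP Py; apply/asboolP; apply: sub_lin.
Qed.

HB.instance Definition _ n :=
  GRing.isSubmodClosed.Build K (O n) (@subb n) (subb_submod n).

Record sub_elt n := SubElt { sub_val : O n; _ : sub_val \in @subb n }.

HB.instance Definition _ n := [isSub for @sub_val n].
HB.instance Definition _ n := [Choice of sub_elt n by <:].
HB.instance Definition _ n := [SubChoice_isSubLmodule of sub_elt n by <:].

Lemma sub_eltP n (x : sub_elt n) : P n (sub_val x).
Proof. exact/asboolP/(valP x). Qed.

Definition sub_space (n : nat) : lmodType K := sub_elt n.

Definition subop_one : sub_space 0 := SubElt (asboolT (sub_one P)).

Definition subop_comp n m (i : 'I_n.+1) (x : sub_space n) (y : sub_space m) :
    sub_space (n + m) :=
  SubElt (asboolT (sub_comp i (sub_eltP x) (sub_eltP y))).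

Lemma sub_val_gcast m n (e : m = n) (x : sub_space m) :
  sub_val (gcast e x) = gcast e (sub_val x).
Proof. by case: _ / e. Qed.

Lemma subop_comp_linl n m (i : 'I_n.+1) (y : sub_space m) :
  linear (fun x : sub_space n => subop_comp i x y).
Proof. by move=> c u v; apply: val_inj; exact: op_comp_linl. Qed.

Lemma subop_comp_linr n m (i : 'I_n.+1) (x : sub_space n) :
  linear (fun y : sub_space m => subop_comp i x y).
Proof. by move=> c u v; apply: val_inj; exact: op_comp_linr. Qed.

Lemma subop_comp1x m (y : sub_space m) : subop_comp ord0 subop_one y = y.
Proof. by apply: val_inj; exact: op_comp1x. Qed.

Lemma subop_compx1 n (i : 'I_n.+1) (x : sub_space n) :
  gcast (addn0 n) (subop_comp i x subop_one) = x.
Proof. by apply: val_inj; rewrite /= sub_val_gcast; exact: op_compx1. Qed.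

Lemma subop_compA n m p (x : sub_space n) (y : sub_space m) (z : sub_space p)
    (i : 'I_n.+1) (j : 'I_m.+1) (k : 'I_(n + m).+1) :
  k = (i + j)%N :> nat ->
  subop_comp i x (subop_comp j y z)
  = gcast (esym (addnA n m p)) (subop_comp k (subop_comp i x y) z).
Proof.
by move=> ek; apply: val_inj; rewrite /= sub_val_gcast; exact: op_compA.
Qed.

Lemma subop_compAC n m p (x : sub_space n) (y : sub_space m) (z : sub_space p)
    (i k : 'I_n.+1) (i' : 'I_(n + p).+1) (k' : 'I_(n + m).+1) :
  (i < k)%N -> i' = i :> nat -> k' = (k + m)%N :> nat ->
  subop_comp i' (subop_comp k x z) y
  = gcast (addnAC n m p) (subop_comp k' (subop_comp i x y) z).
Proof.
move=> ik ei ek; apply: val_inj; rewrite /= sub_val_gcast.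
exact: op_compAC.
Qed.

Definition suboperad_operad : operad K :=
  Operad subop_comp_linl subop_comp_linr subop_comp1x subop_compx1
    subop_compA subop_compAC.

End SuboperadOperad.

Section QuotientOperad.
Variables (K : fieldType) (O : operad K) (I : ideal O).
Local Open Scope quotient_scope.

Definition idlb n : pred (O n) := fun x => `[< I n x >].

Lemma idlb_submod n : submod_closed (@idlb n).
Proof.
split; first by apply/asboolP; apply: idl0.
by move=> c x y /asboolP Px /asboolP Py; apply/asboolP; apply: idl_lin.
Qed.

HB.instance Definition _ n :=
  GRing.isSubmodClosed.Build K (O n) (@idlb n) (idlb_submod n).

Definition idl_closed n : zmodClosed (O n) :=
  GRing.ZmodClosed.clone (O n) (@idlb n) _.

Definition quo_elt n := Quotient.quot (idl_closed n).

HB.instance Definition _ n := GRing.Zmodule.on (quo_elt n).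
HB.instance Definition _ n : EqQuotient (O n) _ (quo_elt n) :=
  EqQuotient.on (quo_elt n).

Definition quo_pi n (x : O n) : quo_elt n := \pi_(quo_elt n) x.

Lemma quo_piP n (x y : O n) : quo_pi x = quo_pi y <-> I n (x - y).
Proof.
split=> [/eqP|h]; first by rewrite -Quotient.idealrBE => /asboolP.
by apply/eqP; rewrite -Quotient.idealrBE; apply/asboolP.
Qed.

Lemma quo_reprK n (u : quo_elt n) : quo_pi (repr u) = u.
Proof. exact: reprK. Qed.

Lemma quo_reprP n (x : O n) : I n (repr (quo_pi x) - x).
Proof. by apply/quo_piP; rewrite quo_reprK. Qed.

Lemma quo_piD n (x y : O n) : quo_pi (x + y) = quo_pi x + quo_pi y.
Proof. exact: (@raddfD _ _ (\pi_(Quotient.quot (idl_closed n)))). Qed.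

Definition quo_scale n (c : K) (u : quo_elt n) : quo_elt n :=
  quo_pi (c *: repr u).

Lemma idlZ n c (x : O n) : I n x -> I n (c *: x).
Proof.
by move=> Ix; rewrite -[_ *: _]addr0; apply: idl_lin => //; apply: idl0.
Qed.

Lemma idlD n (x y : O n) : I n x -> I n y -> I n (x + y).
Proof. by move=> Ix Iy; rewrite -[x]scale1r; apply: idl_lin. Qed.

Lemma quo_piZ n c (x : O n) : quo_scale c (quo_pi x) = quo_pi (c *: x).
Proof. by apply/quo_piP; rewrite -scalerBr; apply/idlZ/quo_reprP. Qed.

Lemma quo_scaleA n a b (u : quo_elt n) :
  quo_scale a (quo_scale b u) = quo_scale (a * b) u.
Proof. by rewrite -[u]quo_reprK !quo_piZ scalerA. Qed.

Lemma quo_scale1 n : left_id 1 (@quo_scale n).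
Proof. by move=> u; rewrite -[u]quo_reprK !quo_piZ scale1r. Qed.

Lemma quo_scaleDr n : right_distributive (@quo_scale n) +%R.
Proof.
move=> c u v; rewrite -[u]quo_reprK -[v]quo_reprK -quo_piD !quo_piZ.
by rewrite scalerDr quo_piD.
Qed.

Lemma quo_scaleDl n (u : quo_elt n) : {morph (@quo_scale n)^~ u : a b / a + b}.
Proof.
by move=> a b; rewrite -[u]quo_reprK !quo_piZ scalerDl quo_piD.
Qed.

HB.instance Definition _ n := GRing.Zmodule_isLmodule.Build K (quo_elt n)
  (@quo_scaleA n) (@quo_scale1 n) (@quo_scaleDr n) (@quo_scaleDl n).

Definition quo_space (n : nat) : lmodType K := quo_elt n.

Lemma quo_pi_linear n : linear (@quo_pi n : O n -> quo_space n).
Proof. by move=> c x y; rewrite quo_piD -quo_piZ. Qed.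

Definition quo_one : quo_space 0 := quo_pi (op_one O).

Definition quo_comp n m (i : 'I_n.+1) (u : quo_space n) (v : quo_space m) :
    quo_space (n + m) :=
  quo_pi (repr u \o_(i) repr v).

Lemma quo_compE n m (i : 'I_n.+1) (x : O n) (y : O m) :
  quo_comp i (quo_pi x) (quo_pi y) = quo_pi (x \o_(i) y).
Proof.
apply/quo_piP; set x' := repr _; set y' := repr _.
have -> : x' \o_(i) y' - x \o_(i) y
        = (x' - x) \o_(i) y' + x \o_(i) (y' - y).
  have -> : (x' - x) \o_(i) y' = x' \o_(i) y' - x \o_(i) y'.
    by rewrite addrC -scaleN1r (op_comp_linl i y') scaleN1r addrC.
  have -> : x \o_(i) (y' - y) = x \o_(i) y' - x \o_(i) y.
    by rewrite addrC -scaleN1r (op_comp_linr i x) scaleN1r addrC.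
  by rewrite addrA subrK.
by apply: idlD; [apply: idl_compl | apply: idl_compr]; apply: quo_reprP.
Qed.

Lemma quo_pi_gcast m n (e : m = n) (x : O m) :
  gcast e (quo_pi x : quo_space m) = quo_pi (gcast e x).
Proof. by case: _ / e. Qed.

Lemma quo_comp_linl n m (i : 'I_n.+1) (v : quo_space m) :
  linear (fun u : quo_space n => quo_comp i u v).
Proof.
move=> c u w; rewrite -[u]quo_reprK -[w]quo_reprK -[v]quo_reprK.
by rewrite -quo_pi_linear !quo_compE op_comp_linl quo_pi_linear.
Qed.

Lemma quo_comp_linr n m (i : 'I_n.+1) (u : quo_space n) :
  linear (fun v : quo_space m => quo_comp i u v).
Proof.
move=> c v w; rewrite -[u]quo_reprK -[w]quo_reprK -[v]quo_reprK.
by rewrite -quo_pi_linear !quo_compE op_comp_linr quo_pi_linear.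
Qed.

Lemma quo_comp1x m (v : quo_space m) : quo_comp ord0 quo_one v = v.
Proof. by rewrite -[v]quo_reprK quo_compE op_comp1x. Qed.

Lemma quo_compx1 n (i : 'I_n.+1) (u : quo_space n) :
  gcast (addn0 n) (quo_comp i u quo_one) = u.
Proof. by rewrite -[u]quo_reprK quo_compE quo_pi_gcast op_compx1. Qed.

Lemma quo_compA n m p (u : quo_space n) (v : quo_space m) (w : quo_space p)
    (i : 'I_n.+1) (j : 'I_m.+1) (k : 'I_(n + m).+1) :
  k = (i + j)%N :> nat ->
  quo_comp i u (quo_comp j v w)
  = gcast (esym (addnA n m p)) (quo_comp k (quo_comp i u v) w).
Proof.
move=> ek; rewrite -[u]quo_reprK -[v]quo_reprK -[w]quo_reprK.
by rewrite !quo_compE quo_pi_gcast; congr quo_pi; apply: op_compA.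
Qed.

Lemma quo_compAC n m p (u : quo_space n) (v : quo_space m) (w : quo_space p)
    (i k : 'I_n.+1) (i' : 'I_(n + p).+1) (k' : 'I_(n + m).+1) :
  (i < k)%N -> i' = i :> nat -> k' = (k + m)%N :> nat ->
  quo_comp i' (quo_comp k u w) v
  = gcast (addnAC n m p) (quo_comp k' (quo_comp i u v) w).
Proof.
move=> ik ei ek; rewrite -[u]quo_reprK -[v]quo_reprK -[w]quo_reprK.
by rewrite !quo_compE quo_pi_gcast; congr quo_pi; apply: op_compAC.
Qed.

Definition quotient_operad : operad K :=
  Operad quo_comp_linl quo_comp_linr quo_comp1x quo_compx1
    quo_compA quo_compAC.

End QuotientOperad.

(* An arc is a pair of vertices x < y of the polygon with vertices
   0, ..., n + 1, i.e. the vertices 1, ..., arity + 1 shifted by one. *)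
Definition arcb n : pred ('I_n.+2 * 'I_n.+2) := fun a => (a.1 < a.2)%N.

Definition arc n := {a : 'I_n.+2 * 'I_n.+2 | arcb a}.

(* The side condition says that the label is 0 in arity 1 (n = 0). *)
Record clique n := Clique {
  clique_fun : {ffun arc n -> int};
  _ : (n == 0%N) ==> (clique_fun == [ffun => 0])
}.

HB.instance Definition _ n := [isSub for @clique_fun n].
HB.instance Definition _ n := [Choice of clique n by <:].

(* The label p(x, y), extended by 0 when (x, y) is not an arc. *)
Definition lab n (p : clique n) (x y : nat) : int :=
  if (x < y)%N then oapp (clique_fun p) 0 (insub (inord x, inord y)) else 0.

Lemma lab_oapp n (p : clique n) (u v : 'I_n.+2) :
  lab p u v = oapp (clique_fun p) 0 (insub (u, v)).
Proof.
rewrite /lab !inord_val; case: ltnP => // vu.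
by rewrite insubF // /arcb /= ltnNge vu.
Qed.

Lemma lab_out n (p : clique n) x y : ~~ (x < y < n.+2)%N -> lab p x y = 0.
Proof.
rewrite /lab; case: ltnP => //= xy; rewrite -leqNgt => ny.
rewrite insubF // /arcb /= [inord y](_ : _ = ord0) //.
by rewrite /inord /insubd insubF // ltnNge ny.
Qed.

Lemma clique_ext n (p q : clique n) :
  (forall x y, (x < y < n.+2)%N -> lab p x y = lab q x y) -> p = q.
Proof.
move=> e; apply/val_inj/ffunP => -[[u v] uv] /=.
have := e u v; rewrite !lab_oapp /= (insubT (@arcb _) uv).
by apply; rewrite (uv : (u < v)%N) ltn_ord.
Qed.

Lemma lab_arity1 (p : clique 0) x y : lab p x y = 0.
Proof.
rewrite /lab; case: p => f /= /eqP ->; case: ifP => // _.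
by case: insub => //= a; rewrite ffunE.
Qed.

(* Here q has arity m + 1; since x, y and i are all numbered from 0, the label
   p_i of the edge at input i is lab p i i.+1 and the base label q_0 is
   lab q 0 m.+1. *)
Definition clique_comp_lab n m (i : nat) (p : clique n) (q : clique m)
    (x y : nat) : int :=
  if (y <= i)%N then lab p x y
  else if (x <= i)%N && (i + m.+1 <= y)%N && ((x, y) != (i, i + m.+1)%N)
  then lab p x (y - m)
  else if (i + m.+1 <= x)%N then lab p (x - m) (y - m)
  else if (i <= x)%N && (y <= i + m.+1)%N && ((x, y) != (i, i + m.+1)%N)
  then lab q (x - i) (y - i)
  else if (x, y) == (i, i + m.+1)%N then lab p i i.+1 + lab q 0 m.+1
  else 0.

Lemma clique_comp_subproof n m (i : 'I_n.+1) (p : clique n) (q : clique m) :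
  (n + m == 0)%N ==>
  ([ffun a : arc (n + m) => clique_comp_lab i p q (val a).1 (val a).2]
   == [ffun => 0]).
Proof.
apply/implyP; rewrite addn_eq0 => /andP[/eqP n0 /eqP m0]; subst n m.
apply/eqP/ffunP => a; rewrite !ffunE /clique_comp_lab !lab_arity1 addr0.
by do !case: ifP => // _.
Qed.

Definition clique_comp n m (i : 'I_n.+1) (p : clique n) (q : clique m) :
    clique (n + m) :=
  Clique (clique_comp_subproof i p q).

Lemma lab_comp n m (i : 'I_n.+1) (p : clique n) (q : clique m) x y :
  lab (clique_comp i p q) x y
  = if (x < y < (n + m).+2)%N then clique_comp_lab i p q x y else 0.
Proof.
case: ifP => [/andP[xy yn]|/negbT]; last exact: lab_out.
have xn := ltn_trans xy yn.
rewrite -[x in LHS](inordK xn) -[y in LHS](inordK yn) lab_oapp.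
have h : @arcb (n + m) (inord x, inord y) by rewrite /arcb /= !inordK.
by rewrite (insubT (@arcb _) h) /= ffunE /= !inordK.
Qed.

Lemma lab_cast n m (e : n = m) (p : clique n) x y :
  lab (scast (F := fun k => clique k : choiceType) e p) x y = lab p x y.
Proof. by case: _ / e. Qed.

Definition clique_one : clique 0 :=
  @Clique 0 [ffun => 0] (eqxx _).

Lemma clique_one_lab x y : lab clique_one x y = 0.
Proof. exact: lab_arity1. Qed.

Variant clique_comp_spec n m (i : nat) (p : clique n) (q : clique m)
    (x y : nat) : int -> Prop :=
| CompLeft of (y <= i)%N : clique_comp_spec i p q x y (lab p x y)
| CompOver1 of (x < i)%N & (i + m < y)%N :
    clique_comp_spec i p q x y (lab p x (y - m))
| CompOver2 of x = i & (i + m.+1 < y)%N :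
    clique_comp_spec i p q x y (lab p i (y - m))
| CompRight of (i + m < x)%N :
    clique_comp_spec i p q x y (lab p (x - m) (y - m))
| CompIn1 of (i < x)%N & (y <= i + m.+1)%N :
    clique_comp_spec i p q x y (lab q (x - i) (y - i))
| CompIn2 of x = i & (y <= i + m)%N & (i < y)%N :
    clique_comp_spec i p q x y (lab q 0 (y - i))
| CompBase of x = i & y = (i + m.+1)%N :
    clique_comp_spec i p q x y (lab p i i.+1 + lab q 0 m.+1)
| CompCross1 of (x < i)%N & (i < y)%N & (y <= i + m)%N :
    clique_comp_spec i p q x y 0
| CompCross2 of (i < x)%N & (x <= i + m)%N & (i + m.+1 < y)%N :
    clique_comp_spec i p q x y 0.

Lemma clique_compP n m (i : 'I_n.+1) (p : clique n) (q : clique m) x y :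
  (x < y)%N -> (y <= (n + m).+1)%N ->
  clique_comp_spec i p q x y (lab (clique_comp i p q) x y).
Proof.
move=> xy yn; rewrite lab_comp xy ltnS yn /= /clique_comp_lab !xpair_eqE.
case: ifP => h1; first by constructor.
case: ifP => h2.
  have [xi|xi] := ltnP x i; first by constructor; lia.
  by have -> : x = i by [lia]; constructor; lia.
case: ifP => h3; first by constructor; lia.
case: ifP => h4.
  have [xi|xi] := ltnP i x; first by constructor; lia.
  by have ei : x = i by [lia]; rewrite ei subnn; constructor; lia.
case: ifP => h5; first by constructor; lia.
have [xi|xi] := ltnP x i; first by constructor; lia.
by apply: CompCross2; lia.
Qed.

Ltac clique_cases :=
  repeat (case: clique_compP => *; try lia);
  rewrite ?clique_one_lab ?addr0 ?add0r ?addrA //;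
  try solve [repeat congr (_ + _); congr (lab _ _ _); lia
            | rewrite [RHS]lab_out //; lia].

Lemma clique_comp1x m (q : clique m) : clique_comp ord0 clique_one q = q.
Proof.
apply: clique_ext => x y xym; have e0 : nat_of_ord (@ord0 0) = 0%N by [].
by clique_cases.
Qed.

Definition clique_choice (n : nat) : choiceType := clique n.

Lemma clique_compx1 n (i : 'I_n.+1) (p : clique n) :
  scast (F := clique_choice) (addn0 n) (clique_comp i p clique_one) = p.
Proof.
apply: clique_ext => x y xyn; rewrite lab_cast.
have := ltn_ord i => /= lti.
by clique_cases.
Qed.

Lemma clique_compA n m p (x : clique n) (y : clique m) (z : clique p)
    (i : 'I_n.+1) (j : 'I_m.+1) (k : 'I_(n + m).+1) :
  k = (i + j)%N :> nat ->
  clique_comp i x (clique_comp j y z)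
  = scast (F := clique_choice) (esym (addnA n m p))
      (clique_comp k (clique_comp i x y) z).
Proof.
move=> ek; apply: clique_ext => a b ab; rewrite lab_cast.
have := (ltn_ord i, ltn_ord j) => /= -[lti ltj].
by clique_cases.
Qed.

Lemma clique_compAC n m p (x : clique n) (y : clique m) (z : clique p)
    (i k : 'I_n.+1) (i' : 'I_(n + p).+1) (k' : 'I_(n + m).+1) :
  (i < k)%N -> i' = i :> nat -> k' = (k + m)%N :> nat ->
  clique_comp i' (clique_comp k x z) y
  = scast (F := clique_choice) (addnAC n m p)
      (clique_comp k' (clique_comp i x y) z).
Proof.
move=> ik ei ek; apply: clique_ext => a b ab; rewrite lab_cast.
have := (ltn_ord i, ltn_ord k) => /= -[lti ltk].
by clique_cases.
Qed.

Definition clique_set_operad : set_operad :=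
  @SetOperad clique_choice clique_one clique_comp clique_comp1x
    clique_compx1 clique_compA clique_compAC.

(* T(a; b, c): base a, first edge b, second edge c *)
Definition triangle (a b c : int) : clique 1 :=
  @Clique 1 [ffun u : arc 1 =>
    if (val (val u).1, val (val u).2) == (0, 2)%N then a
    else if (val (val u).1, val (val u).2) == (0, 1)%N then b else c] isT.

(* The operad C Z, for the additive unitary magma of integers *)
Definition CZ (K : fieldType) : operad K := linearization K clique_set_operad.

Definition czT (K : fieldType) (a b c : int) : CZ K 1 :=
  (<< triangle a b c >> : {malg K[clique 1]}).

Inductive tree (G : Type) := Leaf | Node of G & tree G & tree G.
Arguments Leaf {G}.

(* The number of internal nodes, i.e. the number of leaves minus one. *)
Fixpoint degree G (t : tree G) : nat :=
  if t is Node _ l r then (degree l + degree r).+1 else 0.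

(* Grafts s on the i-th leaf of t, leaves being numbered from 0, from left to
   right. *)
Fixpoint graft G (t : tree G) (i : nat) (s : tree G) : tree G :=
  if t is Node g l r then
    if (i <= degree l)%N then Node g (graft l i s) r
    else Node g l (graft r (i - (degree l).+1) s)
  else s.

Lemma degree_graft G (t : tree G) i s : degree (graft t i s) = (degree t + degree s)%N.
Proof.
elim: t i => [|g l IHl r IHr] i //=.
by case: ifP => _ /=; rewrite ?IHl ?IHr; lia.
Qed.

Lemma graft_leaf G (t : tree G) i : graft t i Leaf = t.
Proof.
by elim: t i => [|g l IHl r IHr] i //=; rewrite IHl IHr; case: ifP.
Qed.

Lemma graftA G (t s u : tree G) i j :
  (i <= degree t)%N -> (j <= degree s)%N ->
  graft t i (graft s j u) = graft (graft t i s) (i + j) u.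
Proof.
elim: t i => [|g l IHl r IHr] i /= it js.
  by move: it; rewrite leqn0 => /eqP ->.
case: ifP => il /=; rewrite ?degree_graft.
  by rewrite ifT ?IHl //; lia.
rewrite ifF; last by lia.
by rewrite IHr //; [congr (Node g l (graft _ _ u)); lia | lia].
Qed.

Lemma graftAC G (t s u : tree G) i k :
  (i < k)%N -> (k <= degree t)%N ->
  graft (graft t k u) i s = graft (graft t i s) (k + degree s) u.
Proof.
elim: t i k => [|g l IHl r IHr] i k /= ik kt; first by lia.
have [kl|lk] := leqP k (degree l) => /=.
  rewrite !degree_graft ifT; last by lia.
  by rewrite ifT /= ?degree_graft ?ifT ?IHl //; lia.
have [il|li] := leqP i (degree l) => /=; rewrite ?degree_graft.
  by rewrite ifF; [congr (Node g _ (graft r _ u)); lia | lia].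
rewrite ifF; last by lia.
by rewrite IHr //; [congr (Node g l (graft _ _ u)); lia | lia | lia].
Qed.

Section TreeOperad.
Variable G : choiceType.

Fixpoint tree_encode (t : tree G) : GenTree.tree G :=
  if t is Node g l r
  then GenTree.Node 1 [:: GenTree.Leaf g; tree_encode l; tree_encode r]
  else GenTree.Node 0 [::].

Fixpoint tree_decode (t : GenTree.tree G) : option (tree G) :=
  match t with
  | GenTree.Node 0 [::] => Some Leaf
  | GenTree.Node 1 [:: GenTree.Leaf g; l; r] =>
      if (tree_decode l, tree_decode r) is (Some l', Some r')
      then Some (Node g l' r') else None
  | _ => None
  end.

Lemma tree_encodeK : pcancel tree_encode tree_decode.
Proof. by elim=> [|g l IHl r IHr] //=; rewrite IHl IHr. Qed.

HB.instance Definition _ := Choice.copy (tree G) (pcan_type tree_encodeK).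

Definition deg_tree (n : nat) : choiceType := {t : tree G | degree t == n}.

Definition mk_tree n (t : tree G) (h : degree t == n) : deg_tree n :=
  exist (fun t => degree t == n) t h.

Lemma tree_comp_subproof n m (i : 'I_n.+1) (t : deg_tree n) (s : deg_tree m) :
  degree (graft (val t) i (val s)) == (n + m)%N.
Proof. by rewrite degree_graft (eqP (valP t)) (eqP (valP s)). Qed.

Definition tree_comp n m (i : 'I_n.+1) (t : deg_tree n) (s : deg_tree m) :
    deg_tree (n + m) :=
  mk_tree (tree_comp_subproof i t s).

Definition tree_one : deg_tree 0 := @mk_tree 0 Leaf (eqxx _).

Lemma val_tree_cast m n (e : m = n) (t : deg_tree m) :
  val (scast e t) = val t.
Proof. by case: _ / e. Qed.

Lemma tree_comp1x m (t : deg_tree m) : tree_comp ord0 tree_one t = t.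
Proof. exact: val_inj. Qed.

Lemma tree_compx1 n (i : 'I_n.+1) (t : deg_tree n) :
  scast (addn0 n) (tree_comp i t tree_one) = t.
Proof. by apply: val_inj; rewrite val_tree_cast /= graft_leaf. Qed.

Lemma tree_compA n m p (x : deg_tree n) (y : deg_tree m) (z : deg_tree p)
    (i : 'I_n.+1) (j : 'I_m.+1) (k : 'I_(n + m).+1) :
  k = (i + j)%N :> nat ->
  tree_comp i x (tree_comp j y z)
  = scast (esym (addnA n m p)) (tree_comp k (tree_comp i x y) z).
Proof.
move=> ek; apply: val_inj; rewrite val_tree_cast /= ek graftA //.
  by rewrite (eqP (valP x)) -ltnS.
by rewrite (eqP (valP y)) -ltnS.
Qed.

Lemma tree_compAC n m p (x : deg_tree n) (y : deg_tree m) (z : deg_tree p)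
    (i k : 'I_n.+1) (i' : 'I_(n + p).+1) (k' : 'I_(n + m).+1) :
  (i < k)%N -> i' = i :> nat -> k' = (k + m)%N :> nat ->
  tree_comp i' (tree_comp k x z) y
  = scast (addnAC n m p) (tree_comp k' (tree_comp i x y) z).
Proof.
move=> ik ei ek; apply: val_inj; rewrite val_tree_cast /= ei ek graftAC //.
  by rewrite (eqP (valP y)).
by rewrite (eqP (valP x)) -ltnS.
Qed.

Definition tree_set_operad : set_operad :=
  SetOperad tree_comp1x tree_compx1 tree_compA tree_compAC.

End TreeOperad.

(* The free nonsymmetric operad on a set G of generators of arity 2: the span of
   planar binary trees whose internal nodes are labelled by G. *)
Definition free_operad (K : fieldType) (G : choiceType) : operad K :=
  linearization K (tree_set_operad G).

Definition free_gen (K : fieldType) (G : choiceType) (g : G) :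
    free_operad K G 1 :=
  (<< @mk_tree G 1 (Node g Leaf Leaf) (eqxx _) >> :
     {malg K[deg_tree G 1]}).

Section NCP.
Variable K : fieldType.

(* The generators false and true stand for the two operations of NCP; the inputs
   1 and 2 of an element of arity 2 are ord0 and ord_max. *)
Definition ncp_prec : free_operad K bool 1 := free_gen K false.
Definition ncp_succ : free_operad K bool 1 := free_gen K true.

Variant ncp_relation : graded_pred (free_operad K bool) :=
| NcpRelation : ncp_relation
    (ncp_prec \o_(ord0) ncp_succ - ncp_succ \o_(ord_max) ncp_prec).

Definition NCP : operad K := quotient_operad (generated_ideal ncp_relation).

Variant ncp_triangles : graded_pred (CZ K) :=
| NcpTriangle1 : ncp_triangles (czT K 0 (-1) 0)
| NcpTriangle2 : ncp_triangles (czT K 0 0 (-1)).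

Definition O_NCP : operad K :=
  suboperad_operad (generated_suboperad ncp_triangles).

End NCP.

(* Main.v *)
Require Import Defs.
From mathcomp Require Import all_boot all_order all_algebra.
From HB Require Import structures.
From mathcomp Require Import finmap boolp zify.
From mathcomp.multinomials Require Import monalg.

(** Send the generator of the free operad named prec to [T(0;0,-1)] and the one
    named succ to [T(0;-1,0)].  Since the bases of both triangles carry the unit
    label, composing them never adds two nonzero labels: a planar binary tree
    with [n] internal nodes goes to a single clique, whose labels are [-1] on
    [n] arcs, one for each node, and [0] elsewhere.  If a node has its subtrees
    over the polygons with vertices [a..b] and [b..c], its arc is [(a, b)] for
    succ and [(b, c)] for prec; adding the base to these arcs gives a based
    noncrossing tree.  The linear extension [realize] of this map is an operad
    morphism onto the suboperad generated by the triangles, by the rule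
    [arcs_graft] for the arcs of a grafted tree.  By [first_isomorphism] it
    remains to identify its kernel with the ideal of the relation of NCP.

    The two trees of the relation have the same arcs, so the ideal lies in the
    kernel.  For the converse, orient the relation so that it removes every
    succ node that is the left child of a prec node.  A normal tree can be read
    off its arcs ([arcs_inj]): its root is a succ node exactly when some arc
    starts at the vertex [0]; in that case the farthest end of such an arc is
    the splitting vertex, and in the other case the splitting vertex is the
    nearest start of an arc ending at the last vertex.  Hence two trees with the
    same clique have the same normal form, and so they agree modulo the ideal
    ([eq_tree_clique]).  Sending the clique of a tree to the class of that tree
    is then well defined, and extends to a linear map that recovers the class of
    an element of the free operad from its realization ([realize_retract]); an
    element of the kernel therefore lies in the ideal. *)

Set Implicit Arguments.
Unset Strict Implicit.
Unset Printing Implicit Defensive.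

Import GRing.Theory.
Local Open Scope ring_scope.

(** * The arcs of a tree *)

(** As for the generators of NCP, [true] stands for succ and [false] for prec;
    [k] is the splitting vertex of the node and [n] the last vertex. *)
Definition node_arc (g : bool) (k n : nat) : nat * nat :=
  if g then (0, k)%N else (k, n)%N.

Fixpoint arcs (t : tree bool) (x y : nat) : bool :=
  if t is Node g l r then
    let k := (degree l).+1 in
    [|| (x, y) == node_arc g k (k + (degree r).+1)%N, arcs l x y
      | (k <= x)%N && arcs r (x - k) (y - k)]
  else false.

(** The arc of a node lies over one of its two subtrees, so the base of the
    whole polygon never occurs.  This is what keeps the arcs of distinct nodes
    distinct. *)
Lemma arcs_bounds t x y :
  arcs t x y ->
  (x < y <= (degree t).+1)%N && ((x != 0) || (y != (degree t).+1)%N).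
Proof.
elim: t x y => [|g l IHl r IHr] x y //=.
by case/or3P=> [|/IHl|/andP[kx /IHr]]; case: g; rewrite ?xpair_eqE; lia.
Qed.

(** A vertex of a composite at input [i] with a factor of degree [m] comes from
    the outer polygon when it is [outside]; [collapse] is its number there. *)
Definition outside (i m x : nat) := (x <= i)%N || (i + m < x)%N.
Definition collapse (i m x : nat) := if (x <= i)%N then x else (x - m)%N.

(** Grafting keeps each node together with its label, hence the arcs of both
    trees; only the numbering of the vertices changes. *)
Lemma arcs_graft t i s x y :
  (i <= degree t)%N -> (x < y)%N ->
  arcs (graft t i s) x y =
    ((i <= x)%N && arcs s (x - i) (y - i))
    || [&& outside i (degree s) x, outside i (degree s) y
         & arcs t (collapse i (degree s) x) (collapse i (degree s) y)].
Proof.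
move=> it xy; elim: t i x y it xy => [|g l IHl r IHr] i x y /= it xy.
  by have -> : i = 0%N by [lia]; rewrite !subn0 !andbF orbF.
set m := degree s in IHl IHr *.
have coll z (iz : (i + m < z)%N) : collapse i m z = (z - m)%N.
  by rewrite /collapse ifF //; lia.
have out z (iz : (i + m < z)%N) : outside i m z by rewrite /outside iz orbT.
case: ifP => il /=; rewrite degree_graft -/m.
  (* The arc of the root, then the arcs of the right subtree: both stay outside
     the inserted polygon. *)
  rewrite IHl //.
  have -> : ((x, y) == node_arc g (degree l + m).+1
                 ((degree l + m).+1 + (degree r).+1)%N)
      = [&& outside i m x, outside i m y & (collapse i m x, collapse i m y)
           == node_arc g (degree l).+1 ((degree l).+1 + (degree r).+1)%N].
    rewrite /outside /collapse /node_arc.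
    by case: g (leqP x i) (leqP y i) => -[] ? [] ?; rewrite !xpair_eqE; lia.
  have -> : ((degree l + m).+1 <= x)%N
       && arcs r (x - (degree l + m).+1) (y - (degree l + m).+1)
      = [&& outside i m x, outside i m y, ((degree l).+1 <= collapse i m x)%N
           & arcs r (collapse i m x - (degree l).+1)
               (collapse i m y - (degree l).+1)].
    have [xl|lx] := leqP (degree l + m).+1 x.
      rewrite !out ?coll; try lia.
      have -> : (degree l < x - m)%N by lia.
      by rewrite /=; congr arcs; lia.
    apply/esym/negP=> /and4P[+ _ + _]; rewrite /outside /collapse.
    by case: (leqP x i); lia.
  by lia.
set k := (degree l).+1.
have -> : ((x, y) == node_arc g k (k + (degree r + m).+1)%N)
    = [&& outside i m x, outside i m y & (collapse i m x, collapse i m y)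
         == node_arc g k (k + (degree r).+1)%N].
  rewrite /outside /collapse /node_arc.
  by case: g (leqP x i) (leqP y i) => -[] ? [] ?; rewrite !xpair_eqE; lia.
(* The insertion happens to the right of the splitting vertex [k], so the arcs of
   [l] are numbered as before. *)
have -> : arcs l x y = [&& outside i m x, outside i m y
      & arcs l (collapse i m x) (collapse i m y)].
  have b := @arcs_bounds l.
  have [yl|ly] := leqP y k; last first.
    have -> : arcs l x y = false by apply/negP=> /b; lia.
    apply/esym/negP=> /and3P[_ + /b]; rewrite /outside /collapse.
    by case: (leqP y i); case: (leqP x i) => ? ?; lia.
  have [xi yi] : (x <= i)%N /\ (y <= i)%N by lia.
  by rewrite /outside /collapse xi yi.
have -> : (k <= x)%N && arcs (graft r (i - k) s) (x - k) (y - k)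
    = ((i <= x)%N && arcs s (x - i) (y - i))
      || [&& outside i m x, outside i m y, (k <= collapse i m x)%N
         & arcs r (collapse i m x - k) (collapse i m y - k)].
  have [kx|xk] /= := leqP k x; last first.
    have -> : (i <= x)%N = false by lia.
    by rewrite /collapse ifT; [rewrite leqNgt xk !andbF | lia].
  rewrite IHr; [|lia|lia].
  have -> : (i - k <= x - k)%N = (i <= x)%N by lia.
  have -> : outside (i - k) m (x - k) = outside i m x.
    by rewrite /outside; lia.
  have -> : outside (i - k) m (y - k) = outside i m y.
    by rewrite /outside; lia.
  have -> : (x - k - (i - k) = x - i)%N by lia.
  have -> : (y - k - (i - k) = y - i)%N by lia.
  have [xo|] := boolP (outside i m x) => //=.
  have [yo|] := boolP (outside i m y) => //=.
  move: xo yo; rewrite /outside => xo yo.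
  have cE z : (k <= z)%N ->  (z <= i)%N || (i + m < z)%N ->
      collapse (i - k) m (z - k) = (collapse i m z - k)%N.
    by rewrite /collapse; case: (leqP z i); case: (leqP (z - k) (i - k)); lia.
  rewrite !cE //; last by lia.
  have -> // : (k <= collapse i m x)%N.
  by rewrite /collapse; case: (leqP x i); lia.
by lia.
Qed.

(** * Normal forms of trees *)

Definition is_succ (t : tree bool) := if t is Node g _ _ then g else false.

(** Normal trees for the rewriting of [(a succ b) prec c] into
    [a succ (b prec c)]. *)
Fixpoint normal (t : tree bool) : bool :=
  if t is Node g l r then [&& normal l, normal r & ~~ g ==> ~~ is_succ l]
  else true.

(** Adds a prec root to two normal trees by pushing it down the chain of succ
    nodes at the root of [l]. *)
Fixpoint prec_nf (l r : tree bool) : tree bool :=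
  if l is Node true a b then Node true a (prec_nf b r) else Node false l r.

Fixpoint nf (t : tree bool) : tree bool :=
  match t with
  | Leaf => Leaf
  | Node true l r => Node true (nf l) (nf r)
  | Node false l r => prec_nf (nf l) (nf r)
  end.

Lemma normal_prec_nf l r : normal l -> normal r -> normal (prec_nf l r).
Proof.
elim: l => [|[] a IHa b IHb] /=; first by move=> _ ->.
  by case/and3P=> na nb _ nr; rewrite na IHb.
by move=> /and3P[-> -> ->] ->.
Qed.

Lemma normal_nf t : normal (nf t).
Proof.
by elim: t => [|[] l IHl r IHr] //=; rewrite ?IHl ?IHr ?normal_prec_nf.
Qed.

(** Reduction by the rewriting, inside any tree; symmetry is left out because
    only the passage from a tree to its normal form is considered. *)
Inductive ncp_equiv : tree bool -> tree bool -> Prop :=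
| ncp_refl t : ncp_equiv t t
| ncp_trans t s u : ncp_equiv t s -> ncp_equiv s u -> ncp_equiv t u
| ncp_node g l l' r r' : ncp_equiv l l' -> ncp_equiv r r' ->
    ncp_equiv (Node g l r) (Node g l' r')
| ncp_rot a b c : ncp_equiv (Node false (Node true a b) c)
    (Node true a (Node false b c)).

Lemma prec_nf_equiv l r : ncp_equiv (Node false l r) (prec_nf l r).
Proof.
elim: l => [|[] a IHa b IHb] /=; try exact: ncp_refl.
by apply: (ncp_trans (ncp_rot _ _ _)); apply: ncp_node => //; apply: ncp_refl.
Qed.

Lemma nf_equiv t : ncp_equiv t (nf t).
Proof.
elim: t => [|[] l IHl r IHr] /=; first exact: ncp_refl.
  exact: ncp_node.
exact: (ncp_trans (ncp_node _ IHl IHr) (prec_nf_equiv _ _)).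
Qed.

Lemma degree_equiv t s : ncp_equiv t s -> degree t = degree s.
Proof. by elim=> //= *; lia. Qed.

(** In both trees of [ncp_rot] with vertices [0..n] split at [k1 < k2], the arcs
    of the two nodes are [(0, k1)] and [(k2, n)]. *)
Lemma arcs_equiv t s : ncp_equiv t s -> arcs t =2 arcs s.
Proof.
elim=> {t s} [//|t s u _ IH1 _ IH2|g l l' r r' el IHl er IHr|a b c] x y /=.
- by rewrite IH1.
- by rewrite (degree_equiv el) (degree_equiv er) IHl IHr.
rewrite /node_arc !xpair_eqE.
have -> : (x - (degree a + degree b).+2 = x - (degree a).+1 - (degree b).+1)%N
  by lia.
have -> : (y - (degree a + degree b).+2 = y - (degree a).+1 - (degree b).+1)%N
  by lia.
by have := @arcs_bounds b (x - (degree a).+1) (y - (degree a).+1); lia.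
Qed.

(** All nodes on the left branch of such a tree are prec nodes, and only the
    arc of a succ node on that branch would start at the vertex [0]. *)
Lemma arcs_prec_normal t y : normal t -> ~~ is_succ t -> arcs t 0 y = false.
Proof.
elim: t => [|[] l IHl r _] //= /and3P[nl _ h] _.
by rewrite IHl //= xpair_eqE.
Qed.

Lemma arcs_node g l r :
  let a := node_arc g (degree l).+1 ((degree l).+1 + (degree r).+1) in
  arcs (Node g l r) a.1 a.2.
Proof. by case: g; rewrite /= eqxx. Qed.

Lemma arcs_left g l r x y :
  let k := (degree l).+1 in
  arcs l x y = [&& arcs (Node g l r) x y, (y <= k)%N & (x, y) != (0, k)%N].
Proof.
have := @arcs_bounds l x y.
have := @arcs_bounds r (x - (degree l).+1) (y - (degree l).+1).
by rewrite /= /node_arc; case: g; rewrite !xpair_eqE; lia.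
Qed.

Lemma arcs_right g l r x y :
  let k := (degree l).+1 in
  arcs r x y =
    arcs (Node g l r) (k + x) (k + y) && ((x, y) != (0, (degree r).+1)%N).
Proof.
have := @arcs_bounds l ((degree l).+1 + x) ((degree l).+1 + y).
have := @arcs_bounds r x y.
rewrite /= !addKn leq_addr /=.
by rewrite /node_arc; case: g; rewrite !xpair_eqE; lia.
Qed.

(** For succ, the splitting vertex is the farthest end of an arc from [0]; for
    prec, it is the nearest start of an arc to the last vertex.  In each case the
    arcs of the subtrees cannot do better, because they stay on one side of it. *)
Lemma arcs_split g l r l' r' :
  (degree l + degree r = degree l' + degree r')%N ->
  arcs (Node g l r) =2 arcs (Node g l' r') -> degree l = degree l'.
Proof.
move=> ed e; have := arcs_node g l r; have := arcs_node g l' r'.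
cbv zeta; rewrite -e [in X in _ -> X]e.
rewrite /node_arc; case: g {e}; rewrite /= !xpair_eqE.
  have := @arcs_bounds l 0 (degree l').+1.
  have := @arcs_bounds l' 0 (degree l).+1.
  by lia.
have := @arcs_bounds l (degree l').+1 ((degree l').+1 + (degree r').+1).
have := @arcs_bounds l' (degree l).+1 ((degree l).+1 + (degree r).+1).
by lia.
Qed.

(** The arcs tell the label of the root by [arcs_prec_normal], the sizes of the
    subtrees by [arcs_split], and the arcs of the subtrees by restriction. *)
Lemma arcs_inj t s : normal t -> normal s -> degree t = degree s ->
  arcs t =2 arcs s -> t = s.
Proof.
elim: t s => [|g l IHl r IHr] [|g' l' r'] // nt ns ed e.
have eg : g = g'.
  have hs := arcs_node g l r; have ht := arcs_node g' l' r'.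
  move: hs ht; cbv zeta; rewrite -e [in X in X -> _]e.
  case: g g' nt ns {e ed} => [] [] // nt ns.
    by rewrite (arcs_prec_normal _ ns).
  by rewrite (arcs_prec_normal _ nt).
subst g'; case: ed => ed; have el := arcs_split ed e.
have er : degree r = degree r' by lia.
move: nt ns => /= /and3P[nl nr _] /and3P[nl' nr' _].
congr Node.
  apply: IHl => // x y.
  by rewrite (arcs_left g l r) (arcs_left g l' r') e el.
apply: IHr => // x y.
by rewrite (arcs_right g l r) (arcs_right g l' r') e el er.
Qed.

Lemma eq_arcs_nf t s : degree t = degree s -> arcs t =2 arcs s ->
  nf t = nf s.
Proof.
move=> ed e; apply: arcs_inj; rewrite ?normal_nf //.
  by rewrite -(degree_equiv (nf_equiv t)) -(degree_equiv (nf_equiv s)).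
by move=> x y; rewrite -(arcs_equiv (nf_equiv t)) -(arcs_equiv (nf_equiv s)).
Qed.

(** * The clique of a tree *)

Definition tree_label (t : tree bool) x y : int := - (arcs t x y)%:Z.

Lemma tree_clique_subproof n (t : deg_tree bool n) :
  (n == 0%N) ==>
  ([ffun a : Defs.arc n => tree_label (val t) (val a).1 (val a).2]
   == [ffun => 0]).
Proof.
apply/implyP=> /eqP n0; apply/eqP/ffunP=> a; rewrite !ffunE /tree_label.
by case: t => -[|? ? ?] //= /eqP e; have := etrans e n0.
Qed.

Definition tree_clique n (t : deg_tree bool n) : clique n :=
  Clique (tree_clique_subproof t).

Lemma lab_tree_clique n (t : deg_tree bool n) x y :
  lab (tree_clique t) x y = tree_label (val t) x y.
Proof.
have [/andP[xy yn]|nxy] := boolP (x < y < n.+2)%N; last first.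
  rewrite lab_out // /tree_label; have [/arcs_bounds|//] := boolP (arcs _ _ _).
  by rewrite (eqP (valP t)); move: nxy; lia.
have xn := ltn_trans xy yn.
rewrite -[x in LHS](inordK xn) -[y in LHS](inordK yn) lab_oapp.
have h : @arcb n (inord x, inord y) by rewrite /arcb /= !inordK.
by rewrite (insubT (@arcb _) h) /= ffunE /= !inordK.
Qed.

(** The base of the inner clique is labelled [0], so the sum on the arc where the
    cliques are glued is the label of the outer clique, as in [arcs_graft]. *)
Lemma tree_clique_comp n m (i : 'I_n.+1) (t : deg_tree bool n)
    (s : deg_tree bool m) :
  tree_clique (tree_comp i t s) = clique_comp i (tree_clique t) (tree_clique s).
Proof.
apply: clique_ext => x y /andP[xy yn]; rewrite lab_tree_clique.
have dt := eqP (valP t); have ds := eqP (valP s).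
have it : (i <= degree (val t))%N by rewrite dt -ltnS.
rewrite /tree_label /= arcs_graft // ds.
have bs := @arcs_bounds (val s) (x - i) (y - i); rewrite ds in bs.
(* The label [q_0] of the case [CompBase]. *)
have base : arcs (val s) 0 m.+1 = false.
  by apply/negP => /arcs_bounds; rewrite ds; lia.
case: clique_compP => //;
  rewrite ?lab_tree_clique /tree_label /outside /collapse.
all: move: (arcs (val t)) (arcs (val s)) bs base => at_ as_ bs base.
all: case: (leqP x i) => xi; case: (leqP y i) => yi; try lia.
all: move=> *; subst; rewrite ?subnn in bs *; try lia.
have -> : (i + m.+1 - m = i.+1)%N by lia.
by rewrite addKn base; lia.
Qed.

Definition corolla (g : bool) : deg_tree bool 1 :=
  @mk_tree bool 1 (Node g Leaf Leaf) (eqxx _).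

Lemma tree_clique_gen g :
  tree_clique (corolla g) = triangle 0 (- g%:Z) (- (~~ g)%:Z).
Proof.
apply/val_inj/ffunP => a; rewrite !ffunE /tree_label /= andbF !orbF.
by case: a => -[[[|[|[|x]]] hx] [[|[|[|y]]] hy]] //=; case: g.
Qed.

Lemma tree_clique_one : tree_clique (tree_one bool) = clique_one.
Proof. by apply/val_inj/ffunP => a; rewrite !ffunE. Qed.

(** * Maps on trees that respect the relation of NCP *)

Lemma node_graft G (g : G) l r :
  Node g l r = graft (graft (Node g Leaf Leaf) 1 r) 0 l.
Proof. by []. Qed.

Section Coherence.
Variables (K : fieldType) (O : operad K).
Variable h : forall n, deg_tree bool n -> O n.
Hypothesis h_comp : forall n m (i : 'I_n.+1) (t : deg_tree bool n)
  (s : deg_tree bool m), h (tree_comp i t s) = h t \o_(i) h s.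

Hypothesis h_rel : h (corolla false) \o_(ord0) h (corolla true)
  = h (corolla true) \o_(ord_max) h (corolla false).

(** Degrees are quantified rather than fixed, so that equal values can be
    transported through [graft], whose degree is only provably a sum. *)
Definition same_value t s := degree t = degree s /\
  forall n (ht : degree t == n) (hs : degree s == n),
    h (mk_tree ht) = h (mk_tree hs).

Lemma same_value_refl t : same_value t t.
Proof. by split=> // n ht hs; rewrite (bool_irrelevance ht hs). Qed.

Lemma same_value_graft t t' s s' i : (i <= degree t)%N ->
  same_value t t' -> same_value s s' ->
  same_value (graft t i s) (graft t' i s').
Proof.
move=> it [dt et] [ds es]; split=> [|n hg hg'].
  by rewrite !degree_graft dt ds.
have en : n = (degree t + degree s)%N by rewrite -(eqP hg) degree_graft.
subst n.
have ht' : degree t' == degree t by rewrite dt.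
have hs' : degree s' == degree s by rewrite ds.
pose j := Ordinal (it : (i < (degree t).+1)%N).
have -> : mk_tree hg = tree_comp j (mk_tree (eqxx _)) (mk_tree (eqxx _)).
  exact: val_inj.
have -> : mk_tree hg' = tree_comp j (mk_tree ht') (mk_tree hs').
  exact: val_inj.
by rewrite !h_comp (et _ _ ht') (es _ _ hs').
Qed.

Lemma same_value_rel : same_value
  (Node false (Node true Leaf Leaf) Leaf)
  (Node true Leaf (Node false Leaf Leaf)).
Proof.
split=> // n ht hs; have en : n = (1 + 1)%N by rewrite -(eqP ht).
subst n.
have -> : mk_tree ht = tree_comp ord0 (corolla false) (corolla true).
  exact: val_inj.
have -> : mk_tree hs = tree_comp ord_max (corolla true) (corolla false).
  exact: val_inj.
by rewrite !h_comp.
Qed.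

Lemma same_value_equiv t s : ncp_equiv t s -> same_value t s.
Proof.
elim=> {t s} [t|t s u _ [dt et] _ [ds es]|g l l' r r' _ IHl _ IHr|a b c].
- exact: same_value_refl.
- split=> [|n ht hu]; first by rewrite dt.
  have hs : degree s == n by rewrite -dt.
  by rewrite (et _ ht hs) es.
- rewrite (node_graft g l) (node_graft g l').
  apply: same_value_graft IHl; first by [].
  by apply: same_value_graft IHr; [|exact: same_value_refl].
have -> : Node false (Node true a b) c = graft (graft (graft
  (Node false (Node true Leaf Leaf) Leaf) 2 c) 1 b) 0 a by [].
have -> : Node true a (Node false b c) = graft (graft (graft
  (Node true Leaf (Node false Leaf Leaf)) 2 c) 1 b) 0 a by [].
do 3!(apply: same_value_graft (same_value_refl _); first by []).
exact: same_value_rel.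
Qed.

(** Both trees have the same value as their normal forms, which coincide: a map
    on trees that respects composition and the relation of NCP depends only on
    the clique. *)
Lemma eq_tree_clique n (t s : deg_tree bool n) :
  tree_clique t = tree_clique s -> h t = h s.
Proof.
case: t s => t ht [s hs] e.
have dts : degree t = degree s by rewrite (eqP ht) (eqP hs).
have ets : nf t = nf s.
  apply: eq_arcs_nf => // x y; move: (congr1 (fun c => lab c x y) e).
  by rewrite !lab_tree_clique /tree_label /=; lia.
have [dt et] := same_value_equiv (nf_equiv t).
have [_ es] := same_value_equiv (nf_equiv s).
have hn : degree (nf t) == n by rewrite -dt.
rewrite (et _ ht hn); rewrite ets in hn *.
by rewrite (es _ hs hn).
Qed.

End Coherence.

(** * The first isomorphism theorem for operads *)

Section FirstIsomorphism.
Variables (K : fieldType) (L C : operad K) (I : ideal L) (P : suboperad C).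
Variable phi : forall n, {linear L n -> C n}.
Hypothesis phi_one : phi 0 (op_one L) = op_one C.
Hypothesis phi_comp : forall n m (i : 'I_n.+1) (x : L n) (y : L m),
  phi (n + m) (x \o_(i) y) = phi n x \o_(i) phi m y.
Hypothesis phi_ker : forall n x, I n x <-> phi n x = 0.
Hypothesis phi_img : forall n y, P n y <-> exists x, phi n x = y.

Let lift n (y : sub_space P n) : L n :=
  sval (cid ((phi_img (sub_val y)).1 (sub_eltP y))).

Let phi_lift n (y : sub_space P n) : phi n (lift y) = sub_val y.
Proof. by rewrite /lift; case: cid. Qed.

Let quo_piE n (x y : L n) :
  phi n x = phi n y -> quo_pi I x = quo_pi I y.
Proof. by move=> e; apply/quo_piP/phi_ker; rewrite linearB e /= subrr. Qed.

Definition img_to_quo n (y : sub_space P n) : quo_space I n :=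
  quo_pi I (lift y).

Lemma img_to_quo_linear n : linear (@img_to_quo n).
Proof.
move=> c y z; rewrite /img_to_quo -quo_pi_linear; apply: quo_piE.
by rewrite linearP !phi_lift.
Qed.

HB.instance Definition _ n := GRing.isLinear.Build K (sub_space P n)
  (quo_space I n) *:%R (@img_to_quo n) (@img_to_quo_linear n).

Let img_elt n (u : quo_space I n) : sub_space P n :=
  SubElt (asboolT ((phi_img (phi n (repr u))).2 (ex_intro _ _ erefl))).

(** Defined on the image by choosing preimages: the choice is irrelevant modulo
    the kernel, which gives linearity and compatibility with composition. *)
Lemma first_isomorphism :
  operad_isomorphic (suboperad_operad P) (quotient_operad I).
Proof.
exists (fun n => (@img_to_quo n : {linear _ -> _})); split=> [n||n m i x y].
- exists (@img_elt n) => [y|u].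
    apply: val_inj => /=; rewrite -phi_lift; apply/eqP; rewrite -subr_eq0.
    by rewrite -linearB; apply/eqP/phi_ker; exact: quo_reprP.
  rewrite -[RHS]quo_reprK; apply: quo_piE; exact: phi_lift.
- by apply: quo_piE; rewrite phi_lift phi_one.
apply: etrans (esym (quo_compE _ _ _ _)); apply: quo_piE.
by rewrite phi_comp !phi_lift.
Qed.

End FirstIsomorphism.

(** * Realization of the free operad by cliques *)

Lemma op_comp0l (K : fieldType) (O : operad K) n m (i : 'I_n.+1) (y : O m) :
  (0 : O n) \o_(i) y = 0.
Proof.
have /= := op_comp_linl i y (-1) 0 0.
by rewrite scaler0 addr0 scaleN1r addNr.
Qed.

Lemma op_comp0r (K : fieldType) (O : operad K) n m (i : 'I_n.+1) (x : O n) :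
  x \o_(i) (0 : O m) = 0.
Proof.
have /= := op_comp_linr i x (-1) (0 : O m) 0.
by rewrite scaler0 addr0 scaleN1r addNr.
Qed.

Section Realization.
Variable K : fieldType.

Local Notation free := (free_operad K bool).

Definition realize n : free n -> CZ K n :=
  lin_ext (V := CZ K n) (fun t => << tree_clique t >>).

HB.instance Definition _ n := GRing.isLinear.Build K (free n) (CZ K n) *:%R
  (@realize n) (lin_ext_linear _).

Lemma realizeU n (t : deg_tree bool n) :
  realize (<< t >> : free n) = << tree_clique t >>.
Proof. exact: lin_extU. Qed.

Lemma realize_one : realize (op_one free) = op_one (CZ K).
Proof. by rewrite realizeU tree_clique_one. Qed.

Lemma realize_comp n m (i : 'I_n.+1) (x : free n) (y : free m) :
  realize (x \o_(i) y) = realize x \o_(i) realize y.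
Proof.
move: x; apply: lin_eq => [c u v|c u v|t].
- by rewrite op_comp_linl linearP.
- by rewrite linearP op_comp_linl.
move: y; apply: lin_eq => [c u v|c u v|s].
- by rewrite op_comp_linr linearP.
- by rewrite linearP op_comp_linr.
apply: etrans (congr1 (@realize _) (lin_compU K i t s)) _.
rewrite !realizeU tree_clique_comp; exact/esym/lin_compU.
Qed.

Lemma realize_gen g : realize (free_gen K g) = czT K 0 (- g%:Z) (- (~~ g)%:Z).
Proof. by rewrite realizeU tree_clique_gen. Qed.

Lemma tree_clique_rel :
  tree_clique (tree_comp ord0 (corolla false) (corolla true))
  = tree_clique (tree_comp ord_max (corolla true) (corolla false)).
Proof.
apply: clique_ext => x y _; rewrite !lab_tree_clique /tree_label.
by rewrite (arcs_equiv (ncp_rot Leaf Leaf Leaf)).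
Qed.

(** The relation holds because the two composites are the same clique of arity
    three, with [-1] on its first and last edges and [0] on all other arcs. *)
Lemma realize_rel : realize (ncp_prec K) \o_(ord0) realize (ncp_succ K)
  = realize (ncp_succ K) \o_(ord_max) realize (ncp_prec K).
Proof.
have r b : realize (free_gen K b) = << tree_clique (corolla b) >>.
  exact: realizeU.
have c b b' (i : 'I_2) : realize (free_gen K b) \o_(i) realize (free_gen K b')
    = << tree_clique (tree_comp i (corolla b) (corolla b')) >>.
  rewrite tree_clique_comp.
  (* Rewriting with [r] would compare the two generators by unfolding them. *)
  apply: etrans (f_equal2 (@op_comp K (CZ K) 1 1 i) (r b) (r b')) _.
  exact: lin_compU.
have e : << tree_clique (tree_comp ord0 (corolla false) (corolla true)) >>
    = << tree_clique (tree_comp ord_max (corolla true) (corolla false)) >>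
    :> CZ K (1 + 1).
  by rewrite tree_clique_rel.
exact: etrans (c false true ord0) (etrans e (esym (c true false ord_max))).
Qed.

Lemma realize_ideal n (x : free n) :
  generated_ideal (@ncp_relation K) n x -> realize x = 0.
Proof.
elim=> {n x} [n x []|n|n c x y _ ex _ ey|n m i x y _ ex|n m i x y _ ey].
- apply: etrans (linearB _ _ _) _; apply/eqP; rewrite subr_eq0; apply/eqP.
  apply: etrans (realize_comp _ _ _) (etrans realize_rel _).
  exact: esym (realize_comp _ _ _).
- exact: linear0.
- by rewrite linearP /= ex ey scaler0 addr0.
- by rewrite realize_comp ex op_comp0l.
by rewrite realize_comp ey op_comp0r.
Qed.

Definition tree_class n (t : deg_tree bool n) : NCP K n :=
  quo_pi (generated_ideal (@ncp_relation K)) (<< t >> : free n).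

Lemma tree_class_eq n (t s : deg_tree bool n) :
  tree_clique t = tree_clique s -> tree_class t = tree_class s.
Proof.
apply: (eq_tree_clique (O := NCP K)) => [n' m i u v|].
  rewrite /tree_class; apply: etrans (esym (quo_compE _ _ _ _)).
  by congr quo_pi; exact/esym/lin_compU.
apply: etrans (quo_compE _ _ _ _) _; apply: etrans (esym (quo_compE _ _ _ _)).
by apply/quo_piP; apply: gen_idl_in; exact: NcpRelation.
Qed.

(** A linear retraction needs a value on every clique, hence [0] on those which
    do not come from a tree. *)
Definition clique_class n (c : clique n) : NCP K n :=
  if pselect (exists t, tree_clique t = c) is left e
  then tree_class (sval (cid e)) else 0.

Lemma clique_classE n (t : deg_tree bool n) :
  clique_class (tree_clique t) = tree_class t.
Proof.
rewrite /clique_class; case: pselect => [e|[]]; last by exists t.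
by apply: tree_class_eq; case: cid.
Qed.

(** A left inverse of [realize] modulo the ideal, which forces the kernel of
    [realize] into the ideal. *)
Lemma realize_retract n (x : free n) :
  lin_ext (@clique_class n) (realize x)
  = quo_pi (generated_ideal (@ncp_relation K)) x.
Proof.
move: x; apply: lin_eq => [c u v|c u v|t].
- by rewrite !linearP.
- exact: quo_pi_linear.
by rewrite realizeU lin_extU clique_classE.
Qed.

Lemma realize_ker n (x : free n) :
  generated_ideal (@ncp_relation K) n x <-> realize x = 0.
Proof.
split=> [|x0]; first exact: realize_ideal.
rewrite -[x]subr0; apply/quo_piP.
by rewrite -!realize_retract x0 !linear0.
Qed.

Definition realizable t := forall n (h : degree t == n),
  gen_sub (@ncp_triangles K) (<< tree_clique (mk_tree h) >> : CZ K n).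

Lemma realizable_graft t s i : (i <= degree t)%N ->
  realizable t -> realizable s -> realizable (graft t i s).
Proof.
move=> it rt rs n h.
have en : n = (degree t + degree s)%N by rewrite -(eqP h) degree_graft.
subst n; pose j := Ordinal (it : (i < (degree t).+1)%N).
have -> : mk_tree h = tree_comp j (mk_tree (eqxx _)) (mk_tree (eqxx _)).
  exact: val_inj.
rewrite tree_clique_comp.
have := gen_sub_comp j (rt _ (eqxx _)) (rs _ (eqxx _)).
by rewrite [X in gen_sub _ X -> _]lin_compU.
Qed.

Lemma realizable_leaf : realizable Leaf.
Proof.
move=> n h; have en : n = 0 by rewrite -(eqP h).
subst n; have -> : mk_tree h = tree_one bool by exact: val_inj.
rewrite tree_clique_one; exact: gen_sub_one.
Qed.

Lemma realizable_corolla g : realizable (Node g Leaf Leaf).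
Proof.
move=> n h; have en : n = 1 by rewrite -(eqP h).
subst n; have -> : mk_tree h = corolla g by exact: val_inj.
rewrite tree_clique_gen; apply: gen_sub_in.
by case: g {h}; [exact: NcpTriangle1|exact: NcpTriangle2].
Qed.

Lemma realizable_tree t : realizable t.
Proof.
elim: t => [|g l IHl r IHr]; first exact: realizable_leaf.
rewrite node_graft; do 2!apply: realizable_graft => //.
exact: realizable_corolla.
Qed.

Lemma realize_img n (y : CZ K n) :
  generated_suboperad (@ncp_triangles K) n y <-> exists x, realize x = y.
Proof.
split=> [|[x <-]].
- elim=> {n y} [n y []|n|n c x y _ [u eu] _ [v ev]||
      n m i x y _ [u eu] _ [v ev]].
  + by exists (free_gen K true); exact: realize_gen.
  + by exists (free_gen K false); exact: realize_gen.
  + by exists 0; exact: linear0.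
  + by exists (c *: u + v); rewrite linearP /= eu ev.
  + by exists (op_one free); exact: realize_one.
  by exists (u \o_(i) v); rewrite realize_comp eu ev.
elim/malg_lin_ind: x => [|c [t h] x IH].
  by rewrite linear0; exact: gen_sub0.
rewrite linearP; apply: gen_sub_lin IH.
by have := realizable_tree h; rewrite -realizeU.
Qed.

End Realization.

Theorem proposition5p1p1 (K : fieldType) (charK0 : [pchar K] =i pred0) :
  operad_isomorphic (O_NCP K) (NCP K).
Proof.
exact: (first_isomorphism (phi := fun n => (@realize K n : {linear _ -> _}))
  (realize_one K) (@realize_comp K) (@realize_ker K) (@realize_img K)).
Qed.
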